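(* Let $G_1$ be a finite, simple, connected graph with $n_1$ vertices that is $k_1$-regular, and let $G_2$ be a finite simple graph (not necessarily connected) with maximum degree at most $k_2$ and minimum degree at least one. Suppose that either $k_1$ is odd and $\frac{k_1^2-k_1}{2}\geq k_2$, or $k_1$ is even, $\frac{k_1^2}{2}\geq k_2$, and $k_1,k_2$ are not both equal to $2$. Then the Cartesian product $G_1\times G_2$ is antimagic.
   Context: All graphs are finite, undirected and simple. An antimagic labeling of a graph with $m$ edges and $n$ vertices is a bijection from the edge set to $\{1,\ldots,m\}$ such that the $n$ vertex sums are pairwise distinct, where the vertex sum at $v$ is the sum of the labels of all edges incident with $v$. A graph is antimagic if it has an antimagic labeling. The Cartesian product $G_1\times G_2$ of $G_1=(V_1,E_1)$ and $G_2=(V_2,E_2)$ has vertex set $V_1\times V_2$, with $(u_1,u_2)$ adjacent to $(v_1,v_2)$ iff either $u_1=v_1$ and $u_2v_2\in E_2$, or $u_2=v_2$ and $u_1v_1\in E_1$. *)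

(* Defs.v *)
From mathcomp Require Import all_boot.

Set Implicit Arguments.
Unset Strict Implicit.
Unset Printing Implicit Defensive.

Record sgraph := SGraph {
  vertex :> finType;
  adj : rel vertex;
  adj_sym : symmetric adj;
  adj_irrefl : irreflexive adj }.

Section Graphs.
Variable G : sgraph.
Implicit Types (v : G) (f : {set G} -> nat).

Definition edges : {set {set G}} :=
  [set [set p.1; p.2] | p : G * G & adj p.1 p.2].

Definition deg v : nat := #|[set w | adj v w]|.

Definition max_degree : nat := \max_(v : G) deg v.

(* The default #|G| exceeds every degree, so it only matters for the graph
   without vertices, whose minimum degree is 0 by this convention. *)
Definition min_degree : nat := \big[minn/#|G|]_(v : G) deg v.

Definition regular (k : nat) : Prop := forall v, deg v = k.

Definition connected : Prop := forall u v : G, connect (@adj G) u v.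

(* f is a bijection from the edges onto {1, ..., m}; its values on sets of
   vertices that are not edges are irrelevant. *)
Definition edge_labeling f : Prop :=
  [/\ {in edges, forall A, 1 <= f A <= #|edges|},
      {in edges &, injective f} &
      forall i, 1 <= i <= #|edges| -> exists2 A, A \in edges & f A = i].

Definition vertex_sum f v : nat := \sum_(A in edges | v \in A) f A.

Definition antimagic_labeling f : Prop :=
  edge_labeling f /\ injective (vertex_sum f).

Definition antimagic : Prop := exists f, antimagic_labeling f.

End Graphs.

Section CartesianProduct.
Variables G1 G2 : sgraph.

Definition cart_adj : rel (G1 * G2) := fun u v =>
  (u.1 == v.1) && adj u.2 v.2 || (u.2 == v.2) && adj u.1 v.1.

Lemma cart_adj_sym : symmetric cart_adj.
Proof.
by move=> u v; rewrite /cart_adj !(eq_sym v.1, eq_sym v.2) !(adj_sym v.1, adj_sym v.2).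
Qed.

Lemma cart_adj_irrefl : irreflexive cart_adj.
Proof. by move=> u; rewrite /cart_adj !adj_irrefl !andbF. Qed.

Definition cart_prod : sgraph := SGraph cart_adj_sym cart_adj_irrefl.

End CartesianProduct.

(* Main.v *)
Require Import Defs.
From mathcomp Require Import all_boot zify.

(* Let m1, m2 be the numbers of edges of G1, G2. The copies of the edges of G2
   receive the labels 1, ..., n1 * m2, one block of n1 consecutive labels per
   edge, and the copies of G1 receive the remaining labels, one block of m1
   labels per vertex v of G2, each block being a translate of one labeling f of
   G1. Inside every block of n1 labels the vertices of G1 are ordered by their
   sums under f, so the sums over one copy of G1 increase strictly; the copies
   of G1 are ordered by the sums that v receives from the bases of the blocks
   of G2. Passing to the next copy adds at least k1 * m1, so copies do not
   interfere once the sums under f vary by less than k1 * m1 - k2 * (n1 - 1).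
   Such an f comes from an Euler circuit, of G1 if k1 is even and of G1 plus an
   apex if k1 is odd, along which the labels alternate between small and large,
   so that consecutive edges of the circuit have nearly constant label sum. *)

Set Implicit Arguments.
Unset Strict Implicit.
Unset Printing Implicit Defensive.


(** * Edges at a vertex, degree sums, and labelings by counting *)

Section Graph.
Variable G : sgraph.
Implicit Types (u v w : G) (A : {set G}) (F : {set G} -> nat).

Lemma mem_edges v w : adj v w -> [set v; w] \in edges G.
Proof. by move=> vw; apply/imsetP; exists (v, w); rewrite ?inE. Qed.

Lemma edgesP A : A \in edges G -> exists v w, adj v w /\ A = [set v; w].
Proof. by case/imsetP=> -[v w]; rewrite inE => vw ->; exists v, w. Qed.

Lemma adj_neq v w : adj v w -> v != w.
Proof. by apply: contraTneq => ->; rewrite adj_irrefl. Qed.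

Lemma set2_injr v w1 w2 : [set v; w1] = [set v; w2] -> w1 = w2.
Proof.
move=> e; have := set22 v w1; rewrite e !inE => /orP[/eqP wv|/eqP //].
by have := set22 v w2; rewrite -e wv !inE orbb => /eqP.
Qed.

Lemma edges_at v : [set A in edges G | v \in A] = [set [set v; w] | w in adj v].
Proof.
apply/setP=> A; rewrite inE; apply/andP/imsetP => [[/edgesP[a [b [ab ->]]]]|].
  rewrite !inE => /orP[]/eqP->; first by exists b.
  by exists a; rewrite ?[_ \in _]adj_sym // setUC.
by case=> w vw ->; rewrite mem_edges // set21.
Qed.

Lemma sum_edges_at v F :
  \sum_(A in edges G | v \in A) F A = \sum_(w | adj v w) F [set v; w].
Proof.
transitivity (\sum_(A in [set A in edges G | v \in A]) F A).
  by apply: eq_bigl => A; rewrite inE.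
by rewrite edges_at big_imset // => w1 w2 _ _; apply: set2_injr.
Qed.

Lemma deg_edges v : deg v = \sum_(A in edges G | v \in A) 1.
Proof. by rewrite sum_edges_at sum1dep_card. Qed.

(** Double counting of incidences: exchanging the sums, each edge is counted once at each of its two
    ends. *)
Lemma sum_deg : \sum_(v : G) deg v = 2 * #|edges G|.
Proof.
rewrite (eq_bigr _ (fun v _ => deg_edges v)) (exchange_big_dep (mem (edges G))) /=; last first.
  by move=> v A _ /andP[].
rewrite mulnC -sum_nat_const; apply: eq_bigr => A /edgesP[a [b [ab ->]]].
have -> : 2 = #|[set a; b]| by rewrite cards2 adj_neq.
rewrite -sum1_card; apply: eq_bigl => v.
by rewrite mem_edges.
Qed.

Lemma regular_card_edges k : regular G k -> #|G| * k = 2 * #|edges G|.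
Proof. by move=> Gk; rewrite -sum_deg (eq_bigr _ (fun v _ => Gk v)) sum_nat_const. Qed.

(** An injection between finite sets of equal size is onto, so labelings need only be checked for
    range and injectivity. *)
Lemma edge_labeling_inj F :
  {in edges G, forall A, 1 <= F A <= #|edges G|} ->
  {in edges G &, injective F} -> edge_labeling F.
Proof.
move=> F_bnd F_inj; split=> // i i_bnd.
have [||| _ iotaE] := @uniq_min_size _ (map F (enum (edges G))) (iota 1 #|edges G|).
- by rewrite map_inj_in_uniq ?enum_uniq // => A B; rewrite !mem_enum; apply: F_inj.
- by move=> _ /mapP[A + ->]; rewrite mem_enum mem_iota add1n ltnS => /F_bnd.
- by rewrite size_iota size_map -cardE.
have := iotaE i; rewrite mem_iota add1n ltnS i_bnd => /mapP[A].
by rewrite mem_enum => eA ->; exists A.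
Qed.

End Graph.

(** The rank is the position in a list sorted by [key]. Ties are broken arbitrarily, hence the weak
    inequality between keys. *)
Lemma rank_by (T : finType) (key : T -> nat) :
  exists r : T -> nat, [/\ injective r, forall x, r x < #|T| &
    forall x y, r x < r y -> key x <= key y].
Proof.
pose s := sort (relpre key leq) (enum T).
have sP x : x \in s by rewrite mem_sort mem_enum.
have sz_s : size s = #|T| by rewrite size_sort cardE.
exists (fun x => index x s); split.
- by move=> x y; apply: index_inj.
- by move=> x; rewrite -sz_s index_mem.
move=> x y; apply: (@sorted_ltn_index _ (relpre key leq)) => //.
  by move=> ? ? ?; apply: leq_trans.
by apply: sort_sorted => ? ?; apply: leq_total.
Qed.

(** * Trails and the existence of Euler circuits *)

Section Euler.
Variable G : sgraph.
Implicit Types (x y u v : G) (p q : seq G).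

Definition trail_edges x p : seq {set G} := pairmap (fun a b => [set a; b]) x p.

Definition trail x p := path (@adj G) x p && uniq (trail_edges x p).

Definition euler_circuit x p :=
  [/\ trail x p, last x p = x & trail_edges x p =i edges G].

Lemma trail_edges_sub x p : path (@adj G) x p -> {subset trail_edges x p <= edges G}.
Proof.
elim: p x => //= y p IHp x /andP[xy yp] A.
by rewrite inE => /predU1P[->|/(IHp _ yp) //]; apply: mem_edges.
Qed.

Lemma trail_edges_vertex x p A u : A \in trail_edges x p -> u \in A -> u \in x :: p.
Proof.
elim: p x => //= y p IHp x; rewrite inE => /predU1P[->|Ap uA].
  by rewrite !inE => /orP[]->; rewrite ?orbT.
by rewrite inE (IHp y) ?orbT.
Qed.

(** Each visit to [u] uses one edge in and one edge out, except that the start has no edge in and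
    the end no edge out. *)
Lemma count_trail_edges x p u : path (@adj G) x p ->
  count (fun A : {set G} => u \in A) (trail_edges x p) + (last x p == u)
  = (x == u) + 2 * count_mem u p.
Proof.
elim: p x => [|y p IHp] x /=; first by rewrite add0n addn0.
move=> /andP[xy /IHp]; rewrite !inE.
have : ~~ ((x == u) && (y == u)).
  by apply: contraTN xy => /andP[/eqP-> /eqP->]; rewrite adj_irrefl.
by rewrite ![u == _]eq_sym; case: (x == u); case: (y == u) => //=; lia.
Qed.

Lemma size_trail x p : trail x p -> size p <= #|edges G|.
Proof.
case/andP=> xp; rewrite -(size_pairmap (fun a b => [set a; b]) x) => /card_uniqP <-.
by apply/subset_leq_card/subsetP/trail_edges_sub.
Qed.

Lemma trail_rcons x p y : trail x p -> adj (last x p) y ->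
  [set last x p; y] \notin trail_edges x p -> trail x (rcons p y).
Proof.
rewrite /trail rcons_path /trail_edges -cats1 pairmap_cat /= cats1 rcons_uniq.
by move=> /andP[-> ->] -> ->.
Qed.

Lemma open_trail_extend x p : (forall v, ~~ odd (deg v)) -> trail x p ->
  last x p != x -> exists y, trail x (rcons p y).
Proof.
move=> deg_even xpT xp_open; have /andP[xpP xpU] := xpT; set z := last x p.
have [/existsP[y /andP[zy yp]]|] :=
    boolP [exists y, adj z y && ([set z; y] \notin trail_edges x p)].
  by exists y; apply: trail_rcons.
rewrite negb_exists => /forallP z_full.
have := count_trail_edges z xpP; rewrite eqxx eq_sym (negPf xp_open).
rewrite -size_filter.
have /card_uniqP <- := filter_uniq (fun A : {set G} => z \in A) xpU.
suff -> : #|[seq A : {set G} <- trail_edges x p | z \in A]| = deg z by have := deg_even z; lia.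
rewrite deg_edges sum1_card; apply: eq_card => A; rewrite mem_filter andbC.
rewrite [RHS]/in_mem /=; have [zA|//] := boolP (z \in A); rewrite ?andbF // !andbT.
apply/idP/idP; first exact: trail_edges_sub.
move=> eA; have : A \in [set A in edges G | z \in A] by rewrite inE eA.
rewrite edges_at => /imsetP[w zw ->]; have := z_full w.
by rewrite [adj z w]zw negbK.
Qed.

(* The trail is restarted at a vertex [a] with an unused edge [ab], which is then
   appended. *)
Lemma closed_trail_extend x p A : connected G -> trail x p -> last x p = x ->
  A \in edges G -> A \notin trail_edges x p ->
  exists y q, trail y q /\ size q = (size p).+1.
Proof.
move=> Gconn xpT xp_closed eA AN.
have [a [b [axp ab abN]]] : exists a b, [/\ a \in x :: p, adj a b &
    [set a; b] \notin trail_edges x p].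
  have [c [d [cd def_A]]] := edgesP eA; rewrite {}def_A in eA AN.
  have [cxp|cxp] := boolP (c \in x :: p); first by exists c, d; split.
  have [/existsP[a /existsP[b /and3P[axp bxp ab]]]|] :=
      boolP [exists a, exists b, [&& a \in x :: p, b \notin x :: p & adj a b]].
    exists a, b; split=> //; apply: contraNN bxp => /trail_edges_vertex; apply.
    exact: set22.
  move=> no_exit; case/negP: cxp; have /connectP[q xq ->] := Gconn x c.
  elim/last_ind: q xq => [|q y IHq] /=; first by rewrite mem_head.
  rewrite rcons_path last_rcons => /andP[/IHq qxp qy].
  apply: contraNT no_exit => yxp; apply/existsP; exists (last x q).
  by apply/existsP; exists y; rewrite qxp yxp.
case/splitPl: axp xpT xp_closed abN => p1 p2 p1a.
rewrite /trail /trail_edges cat_path pairmap_cat last_cat p1a cat_uniq.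
move=> /andP[/andP[xp1 ap2] p12U] p2x abN.
exists a, (rcons (p2 ++ p1) b); split; last by rewrite size_rcons !size_cat addnC.
apply: trail_rcons; rewrite ?last_cat ?p2x ?p1a //.
- by rewrite /trail cat_path ap2 p2x xp1 /trail_edges pairmap_cat p2x uniq_catC cat_uniq.
- by rewrite /trail_edges pairmap_cat p2x mem_cat orbC -mem_cat.
Qed.

Lemma euler_circuit_exists x : connected G -> (forall v, ~~ odd (deg v)) ->
  exists y p, euler_circuit y p.
Proof.
move=> Gconn deg_even.
suff ext n y p : trail y p -> #|edges G| <= size p + n -> exists z q, euler_circuit z q.
  exact: (ext #|edges G| x [::]).
elim: n y p => [|n IHn] y p ypT sz_p.
all: have [y_closed|/(open_trail_extend deg_even ypT)[z yzT]] := eqVneq (last y p) y;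
  last by [have := size_trail yzT; rewrite size_rcons; lia
          |apply: IHn yzT _; rewrite size_rcons; lia].
all: have [/subsetP pE|/subsetPn[A eA AN]] := boolP (edges G \subset trail_edges y p);
  [ exists y, p; split=> // A; apply/idP/idP; last exact: pE;
    by apply: trail_edges_sub; case/andP: ypT
  | have [z [q [zqT sz_q]]] := closed_trail_extend Gconn ypT y_closed eA AN ].
- by have := size_trail zqT; lia.
- by apply: IHn zqT _; lia.
Qed.

End Euler.

(* The labels 1, ..., m in a cyclic order (positions counted from 0) in which
   neighbours sum to m, m + 1 or m + 2; for m = 8 it is 1 7 3 5 4 6 2 8. *)
Definition zigzag m j := if odd j == ~~ odd m && (m./2 <= j) then j.+1 else m - j.

Lemma zigzag_bound m j : j < m -> 0 < zigzag m j <= m.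
Proof. by rewrite /zigzag; case: ifP => _; lia. Qed.

(** For odd [m] the branch [j.+1] gives odd values and [m - j] even ones. For even [m] the first
    half of the positions gives odd values and the second half even ones; within a half, the two
    branches lie on opposite sides of the middle. *)
Lemma zigzag_inj m : {in gtn m &, injective (zigzag m)}.
Proof.
move=> i j; rewrite -!topredE /= /zigzag => im jm.
by case: ifP; case: ifP; lia.
Qed.

(** Neighbours in different branches sum to [m] or [m.+2]. The sum is [m.+1] at the middle for even
    [m], where the branch repeats, and at the wrap-around, where [m] meets 1. *)
Lemma zigzag_step m j : j < m ->
  m <= zigzag m j + zigzag m (j.+1 %% m) <= m.+2.
Proof.
move=> jm; have [j1m|j1m] := ltnP j.+1 m.
  by rewrite modn_small // /zigzag; case: ifP; case: ifP; lia.
have <- : j.+1 = m by lia.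
by rewrite modnn /zigzag; case: ifP; case: ifP; lia.
Qed.

Lemma index_filter (T : eqType) (a : pred T) (s : seq T) z : a z ->
  index z (filter a s) = count a (take (index z s) s).
Proof.
move=> az; elim: s => //= y s IHs; have [->|yz] := eqVneq y z.
  by rewrite az /= eqxx.
by case: ifP => /= ay; rewrite ay ?(negPf yz) IHs.
Qed.

Lemma sum_ord_rot N (F : nat -> nat) :
  \sum_(i < N) F i = \sum_(i < N) F (i.+1 %% N).
Proof.
case: N => [|N]; first by rewrite !big_ord0.
rewrite big_ord_recl big_ord_recr /= modnn addnC; congr (_ + _).
by apply: eq_bigr => i _; rewrite modn_small // ltnS.
Qed.

(** * Labels laid along an Euler circuit *)

Section Circuit.
Variables (G : sgraph) (x : G) (p : seq G).
Hypothesis xpC : euler_circuit x p.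

Let N := size p.
Let es := trail_edges x p.
Let e i := nth set0 es i.

Let sz_es : size es = N. Proof. exact: size_pairmap. Qed.
Let es_uniq : uniq es. Proof. by case: xpC => /andP[]. Qed.
Let es_mem : es =i edges G. Proof. by case: xpC. Qed.

(** The edges at [u] are grouped by visits: a visit at position [i] arrives by [e i] and departs by
    the cyclically next edge. *)
Lemma circuit_sum (F : {set G} -> nat) u :
  \sum_(A in edges G | u \in A) F A =
  \sum_(i < N | nth x p i == u) (F (e i) + F (e (i.+1 %% N))).
Proof.
have [/andP[xpP _] p_closed _] := xpC.
transitivity (\sum_(A <- es | u \in A) F A).
  rewrite -big_filter -[RHS]big_filter; apply: perm_big; apply: uniq_perm.
  - by rewrite filter_uniq // index_enum_uniq.
  - by rewrite filter_uniq.
  by move=> A; rewrite !mem_filter mem_index_enum andbT es_mem andbC.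
rewrite (big_nth set0) sz_es big_mkord big_mkcond /=.
(* Each edge is split into its tail and head terms; rotating the tail terms by one position then
   pairs them with the head terms. *)
transitivity (\sum_(i < N) ((nth x (x :: p) i == u) * F (e i) + (nth x p i == u) * F (e i))).
  apply: eq_bigr => i _; rewrite /e /es /trail_edges (nth_pairmap x) //.
  have /= := pathP x xpP i (ltn_ord i) => adj_i.
  have : ~~ ((nth x (x :: p) i == u) && (nth x p i == u)).
    by apply: contraTN adj_i => /andP[/eqP-> /eqP->]; rewrite adj_irrefl.
  rewrite !inE ![u == _]eq_sym; case: (_ == u); case: (_ == u) => //= _; lia.
rewrite big_split /= (sum_ord_rot _ (fun i => (nth x (x :: p) i == u) * F (e i))).
rewrite -big_split [RHS]big_mkcond /=; apply: eq_bigr => i _.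
suff -> : nth x (x :: p) (i.+1 %% N) = nth x p i by case: (_ == u); lia.
have [iN|iN] := ltnP i.+1 N; first by rewrite modn_small.
have {iN} iN : i.+1 = N by have := ltn_ord i; lia.
have i_last : (size p).-1 = i by move: iN; rewrite /N; lia.
by rewrite iN modnn /= -[LHS]p_closed -nth_last i_last.
Qed.

Variable D : pred {set G}.
Let m := #|[set A in edges G | ~~ D A]|.
Let rs := [seq A <- es | ~~ D A].

Let lab A := if A \in rs then zigzag m (index A rs) else 0.

Let sz_rs : size rs = m.
Proof.
rewrite -(card_uniqP _) ?filter_uniq //; apply: eq_card => A.
by rewrite inE mem_filter es_mem andbC.
Qed.

(** With one dummy in the pair, both bounds reduce to the other label lying between 1 and [m], which
    explains the corrections [m - 1] and 2. With none, the two edges are also cyclic neighbours in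
    [rs], and [zigzag_step] applies. *)
Let lab_step i : i < N -> D (e i) + D (e (i.+1 %% N)) <= 1 ->
  m <= lab (e i) + lab (e (i.+1 %% N)) + (m - 1) * (D (e i) + D (e (i.+1 %% N))) /\
  lab (e i) + lab (e (i.+1 %% N)) + 2 * (D (e i) + D (e (i.+1 %% N))) <= m.+2.
Proof.
move=> iN; have i1N : i.+1 %% N < N by rewrite ltn_mod; lia.
have e_rs j : j < N -> (e j \in rs) = ~~ D (e j).
  by move=> jN; rewrite mem_filter mem_nth ?sz_es // andbT.
have lab_e j : j < N -> ~~ D (e j) -> 0 < lab (e j) <= m.
  by move=> jN Dj; rewrite /lab e_rs // Dj zigzag_bound // -sz_rs index_mem e_rs.
have idx_e j : j < N -> ~~ D (e j) ->
    index (e j) rs = count (fun A => ~~ D A) (take j es).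
  by move=> jN Dj; rewrite /rs index_filter // index_uniq ?sz_es.
have := lab_e _ iN; have := lab_e _ i1N.
case Di: (D (e i)); case Di1: (D (e _)) => //= lab_i1 lab_i _.
- by rewrite {1 3}/lab e_rs // Di /=; have := lab_i1 isT; lia.
- by rewrite [lab (e (_ %% _))]/lab e_rs // Di1 /=; have := lab_i isT; lia.
rewrite muln0 !addn0; apply/andP.
rewrite /lab !e_rs // Di Di1 /=.
suff -> : index (e (i.+1 %% N)) rs = (index (e i) rs).+1 %% m.
  by apply: zigzag_step; rewrite -sz_rs index_mem e_rs // Di.
have idx_i : (index (e i) rs).+1 = count (fun A => ~~ D A) (take i.+1 es).
  rewrite idx_e ?Di // (take_nth set0) ?sz_es // -cats1 count_cat /=.
  by rewrite -/(e i) Di addn0 addn1.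
rewrite idx_i idx_e ?Di1 //; have [i1|i1] := ltnP i.+1 N.
  have Dei1 : ~~ D (e i.+1) by rewrite -(modn_small i1) Di1.
  by rewrite [i.+1 %% N]modn_small // -idx_e // [RHS]modn_small // -sz_rs index_mem e_rs.
have {i1} i1 : i.+1 = N by lia.
by rewrite i1 -sz_es take_size modnn take0 /= -size_filter -/rs sz_rs modnn.
Qed.

(* The edges in [D] are dummies: they get label 0 and are skipped when the
   zigzag sequence is laid along the circuit. *)
Lemma circuit_labeling : exists f : {set G} -> nat,
  [/\ forall A, A \in edges G -> ~~ D A -> 0 < f A <= m,
      {in [pred A | (A \in edges G) && ~~ D A] &, injective f},
      forall A, D A -> f A = 0 &
      forall u, let d := \sum_(A in edges G | u \in A) D A in d <= 1 ->
        m * deg u <= 2 * (vertex_sum f u + (m - 1) * d) /\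
        2 * (vertex_sum f u + 2 * d) <= m.+2 * deg u].
Proof.
have in_rs A : A \in edges G -> ~~ D A -> A \in rs by rewrite mem_filter es_mem => -> ->.
exists lab; split.
- by move=> A eA DA; rewrite /lab in_rs // zigzag_bound // -sz_rs index_mem in_rs.
- move=> A B; rewrite !inE => /andP[eA DA] /andP[eB DB].
  rewrite /lab !in_rs // => zAB; apply: (@index_inj _ A rs); rewrite ?in_rs //.
  by apply: zigzag_inj zAB; rewrite -topredE /= -sz_rs index_mem in_rs.
- by move=> A DA; rewrite /lab mem_filter DA.
move=> u; rewrite /vertex_sum deg_edges !circuit_sum /= => d_le1.
(* The dummies met in one visit are among the [d] dummies at [u], so each visit meets at most
   one. *)
have step (i : 'I_N) : nth x p i == u -> _ := fun iu => @lab_step i (ltn_ord i)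
  (leq_trans (leq_trans (leq_addr _ _) (eq_leq (esym (bigD1 i iu)))) d_le1).
(* The bounds hold visit by visit; a visit counts 2 in the degree, whence the factor 2 on the vertex
   sums. *)
by split; rewrite mulnDr !big_distrr -big_split; apply: leq_sum => i /step [] /=; lia.
Qed.

End Circuit.

(** * Labelings of regular graphs with nearly constant vertex sums *)

(** With m edges and no dummies, every vertex sum lies between [m * h] and [m.+2 * h]. *)
Lemma even_regular_labeling (G : sgraph) h (x : G) :
  connected G -> regular G (2 * h) ->
  exists2 f, edge_labeling f &
    forall u v : G, vertex_sum f u <= vertex_sum f v + 2 * h.
Proof.
move=> Gconn Greg; have [|y [p yp]] := euler_circuit_exists x Gconn.
  by move=> v; rewrite Greg mul2n odd_double.
have [f [f_bnd f_inj _ f_sum]] := circuit_labeling yp pred0.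
have mE : #|[set A in edges G | ~~ pred0 A]| = #|edges G|.
  by apply: eq_card => A; rewrite inE andbT.
rewrite mE in f_bnd f_sum; exists f.
  apply: edge_labeling_inj; first by move=> A eA; apply: f_bnd.
  by move=> A B eA eB; apply: f_inj; rewrite inE ?eA ?eB.
move=> u v; have := f_sum u; have := f_sum v.
by rewrite /= !big1 // !Greg => /(_ isT)[? _] /(_ isT)[_ ?]; nia.
Qed.

Lemma sum_option (T : finType) (P : pred (option T)) (F : option T -> nat) :
  \sum_(a | P a) F a = P None * F None + \sum_(u | P (Some u)) F (Some u).
Proof.
rewrite big_mkcond (bigD1 None) //=; congr (_ + _); first by case: (P None); lia.
rewrite -big_mkcondr /= (reindex_omap Some id) //=; last by case.
by apply: eq_bigl => u; rewrite eqxx andbT.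
Qed.

Lemma min_degree_le (G : sgraph) (v : G) : min_degree G <= deg v.
Proof.
rewrite /min_degree; elim: index_enum (mem_index_enum v) => //= w s IHs.
rewrite big_cons geq_min inE => /predU1P[->|/IHs->]; first by rewrite leqnn.
by rewrite orbT.
Qed.

(** * Odd degree: an apex joined to all vertices *)

Section Apex.
Variable G : sgraph.

Definition apex_adj : rel (option G) := fun a b =>
  match a, b with
  | Some u, Some v => adj u v
  | None, None => false
  | _, _ => true
  end.

Lemma apex_adj_sym : symmetric apex_adj.
Proof. by move=> [u|] [v|] //=; apply: adj_sym. Qed.

Lemma apex_adj_irrefl : irreflexive apex_adj.
Proof. by move=> [u|] //=; apply: adj_irrefl. Qed.

Definition apex : sgraph := SGraph apex_adj_sym apex_adj_irrefl.

Lemma connected_apex : connected apex.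
Proof.
move=> a b; apply: (@connect_trans _ _ (None : apex)).
  by case: a => [u|]; rewrite ?connect0 ?connect1.
by case: b => [u|]; rewrite ?connect0 ?connect1.
Qed.

Lemma apex_deg_Some u : deg (Some u : apex) = (deg u).+1.
Proof. by rewrite /deg -!sum1dep_card sum_option add1n. Qed.

Lemma apex_deg_None : deg (None : apex) = #|G|.
Proof. by rewrite /deg -!sum1dep_card sum_option sum1_card. Qed.

Lemma real_apex_edges :
  [set A in edges apex | None \notin A] = [set [set Some u | u in A] | A : {set G} in edges G].
Proof.
apply/setP=> A; rewrite inE; apply/andP/imsetP.
  case=> /edgesP[[u|] [[v|] [//= uv ->]]]; rewrite !inE ?orbT // => _.
  by exists [set u; v]; rewrite ?mem_edges // imsetU1 imset_set1.
case=> B /edgesP[u [v [uv ->]]] ->; rewrite imsetU1 imset_set1.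
by rewrite (@mem_edges apex) // !inE.
Qed.

(** The apex edges are the dummies, one at each old vertex, whose degree becomes [2 * h + 2]. With m
    edges in [G], the bounds for [d = 1] place every sum between [m * h + 1] and
    [m * h + m + 2 * h]. *)
Lemma odd_regular_labeling h : regular G (2 * h).+1 ->
  exists2 f, edge_labeling f &
    forall u v : G, vertex_sum f u + 1 <= vertex_sum f v + 2 * h + #|edges G|.
Proof.
move=> Greg; have deg_even (a : apex) : ~~ odd (deg a).
  case: a => [u|]; first by rewrite apex_deg_Some Greg /= mul2n odd_double.
  (* The apex has degree [#|G|], which is even because its product with an odd degree is twice the
     number of edges. *)
  by rewrite apex_deg_None; have := regular_card_edges Greg; lia.
have [y [p yp]] := euler_circuit_exists (None : apex) connected_apex deg_even.
have [lab [lab_bnd lab_inj lab0 lab_sum]] :=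
  circuit_labeling yp (fun A : {set apex} => None \in A).
have SomeI : injective (fun A : {set G} => [set Some u | u in A]).
  by apply: imset_inj => ? ? [].
rewrite real_apex_edges card_imset // in lab_bnd lab_sum.
pose f (A : {set G}) := lab [set Some u | u in A].
have lift A : A \in edges G -> ([set Some u | u in A] \in edges apex) &&
    (None \notin [set Some u | u in A]).
  move=> eA; have : [set Some u | u in A] \in [set B in edges apex | None \notin B].
    by rewrite real_apex_edges imset_f.
  by rewrite inE.
exists f.
  apply: edge_labeling_inj => [A /lift/andP[? ?]|A B eA eB fAB]; first exact: lab_bnd.
  by apply/SomeI/lab_inj; rewrite ?inE ?lift.
have sum_f u : vertex_sum f u = vertex_sum (lab : {set apex} -> nat) (Some u).
  rewrite /vertex_sum !sum_edges_at sum_option /= lab0 ?set22 // muln0 add0n.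
  by apply: eq_bigr => v _; rewrite /f imsetU1 imset_set1.
have dummy u : \sum_(A in edges apex | Some u \in A) (None \in A) = 1.
  rewrite sum_edges_at sum_option /= set22 big1 // => v _.
  by rewrite !inE.
(* Positivity keeps the subtraction [m - 1] in the bounds from truncating. *)
move=> u v; have edges_gt0 : 0 < #|edges G|.
  have G_gt0 : 0 < #|G| by apply/card_gt0P; exists u.
  by have := regular_card_edges Greg; lia.
rewrite !sum_f; have := lab_sum (Some u); have := lab_sum (Some v).
rewrite /= !dummy !apex_deg_Some !Greg !muln1 => /(_ isT)[+ _] /(_ isT)[_].
by move: #|edges G| (vertex_sum _ _) (vertex_sum _ _) edges_gt0 => m a b; nia.
Qed.

End Apex.

(** * Labeling the Cartesian product *)

Section Product.
Variables G1 G2 : sgraph.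
Let G := cart_prod G1 G2.

Lemma sum_cart_adj (u : G1) (v : G2) (F : G -> nat) :
  \sum_(w | adj ((u, v) : G) w) F w =
  \sum_(v' | adj v v') F (u, v') + \sum_(u' | adj u u') F (u', v).
Proof.
rewrite (bigID (fun w : G => w.1 == u)) /=; congr (_ + _).
  rewrite (reindex_onto (pair u) snd) /=; last by case=> a b /= /andP[_ /eqP->].
  by apply: eq_bigl => b; rewrite /cart_adj /= adj_irrefl !eqxx andbF orbF !andbT.
rewrite (reindex_onto (pair^~ v) fst) /=.
  apply: eq_bigl => a; rewrite /cart_adj /= adj_irrefl !eqxx andbF !andbT /=.
  by apply: andb_idr; rewrite eq_sym; apply: adj_neq.
by case=> a b /= /andP[/orP[]/andP[/= /eqP<- _]] //; rewrite eqxx.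
Qed.

Lemma cart_deg (u : G1) (v : G2) : deg ((u, v) : G) = deg v + deg u.
Proof. by rewrite /deg -!sum1dep_card sum_cart_adj. Qed.

Lemma cart_card_edges : #|edges G| = #|G1| * #|edges G2| + #|G2| * #|edges G1|.
Proof.
apply/eqP; rewrite -(eqn_pmul2l (isT : 0 < 2)) -sum_deg mulnDr ![2 * (_ * _)]mulnCA.
rewrite -!sum_deg -(pair_big xpredT xpredT (fun u v => deg ((u, v) : G))) /=.
under eq_bigr do under eq_bigr do rewrite cart_deg.
under eq_bigr do rewrite big_split /= sum_nat_const.
by rewrite big_split /= sum_nat_const -big_distrr.
Qed.

Variant cart_edge_spec (A : {set G}) : Prop :=
  | CartEdge2 u v v' of adj v v' & A = [set (u, v); (u, v')]
  | CartEdge1 u u' v of adj u u' & A = [set (u, v); (u', v)].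

Lemma cart_edgeP (A : {set G}) : A \in edges G -> cart_edge_spec A.
Proof.
case/edgesP=> -[u v] [[u' v'] [/orP[]/andP[/= /eqP<- uv] ->]].
  exact: (CartEdge2 uv).
exact: (CartEdge1 uv).
Qed.

Lemma cart_setl (u : G1) (v v' : G2) :
  [set (u, v); (u, v')] = setX [set u] [set v; v'].
Proof. by apply/setP=> -[a b]; rewrite !inE !xpair_eqE andb_orr. Qed.

Lemma cart_setr (u u' : G1) (v : G2) :
  [set (u, v); (u', v)] = setX [set u; u'] [set v].
Proof. by apply/setP=> -[a b]; rewrite !inE !xpair_eqE andb_orl. Qed.

(** The projections recover the type of an edge: [P1] is a singleton exactly for copies of edges of
    [G2]. The sums over [P1] and [P2] merely extract the element of a singleton. *)
Definition cart_labeling (pos : G1 -> nat) (ord : G2 -> nat) (f : {set G1} -> nat)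
    (g : {set G2} -> nat) (A : {set G}) :=
  let P1 := [set w.1 | w in A] in let P2 := [set w.2 | w in A] in
  if #|P1| == 1 then (#|G1| * g P2 + \sum_(u in P1) pos u).+1
  else #|G1| * #|edges G2| + #|edges G1| * \sum_(v in P2) ord v + f P1.

Lemma cart_labeling1 pos ord f g u v v' :
  cart_labeling pos ord f g [set (u, v); (u, v')] = (#|G1| * g [set v; v'] + pos u).+1.
Proof.
by rewrite /cart_labeling !imsetU1 !imset_set1 /= setUid cards1 big_set1.
Qed.

Lemma cart_labeling2 pos ord f g u u' v : adj u u' ->
  cart_labeling pos ord f g [set (u, v); (u', v)] =
  #|G1| * #|edges G2| + #|edges G1| * ord v + f [set u; u'].
Proof.
move=> uu'; rewrite /cart_labeling !imsetU1 !imset_set1 /= setUid big_set1.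
by rewrite cards2 adj_neq.
Qed.

(** Labels of the first type are at most [#|G1| * #|edges G2|], those of the second type exceed it.
    Within a type, block and offset are the digits in base [#|G1|] or [#|edges G1|]. *)
Lemma cart_labelingP pos ord f g :
  injective pos -> (forall u, pos u < #|G1|) -> injective ord -> (forall v, ord v < #|G2|) ->
  edge_labeling f ->
  {in edges G2 &, injective g} -> {in edges G2, forall B, g B < #|edges G2|} ->
  edge_labeling (cart_labeling pos ord f g).
Proof.
move=> pos_inj pos_lt ord_inj ord_lt [f_bnd f_inj _] g_inj g_lt.
have lab1_le u B : B \in edges G2 -> (#|G1| * g B + pos u).+1 <= #|G1| * #|edges G2|.
  move=> /g_lt gB; rewrite -addnS; apply: leq_trans (leq_mul (leqnn _) gB).
  by rewrite mulnS addnC leq_add2r.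
have lab2_le v B : B \in edges G1 -> #|edges G1| * ord v + f B <= #|G2| * #|edges G1|.
  move=> /f_bnd/andP[_ fB]; rewrite [leqRHS]mulnC.
  apply: leq_trans (leq_mul (leqnn _) (ord_lt v)).
  by rewrite mulnS addnC leq_add2r.
have radix d q r q' r' : r < d -> r' < d -> d * q + r = d * q' + r' -> q = q' /\ r = r'.
  move=> rd r'd; rewrite ![d * _]mulnC => e.
  have := congr1 (divn^~ d) e; have := congr1 (modn^~ d) e.
  by rewrite /= !modnMDl !divnMDl ?(leq_trans _ rd) // !modn_small // !divn_small // !addn0.
apply: edge_labeling_inj; rewrite ?cart_card_edges.
  move=> A /cart_edgeP[u v v' vv' ->|u u' v uu' ->].
    by rewrite cart_labeling1 (leq_trans (lab1_le _ _ (mem_edges vv'))) ?leq_addr.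
  rewrite cart_labeling2 // -addnA leq_add2l lab2_le ?mem_edges // andbT.
  by have /andP[f_gt0 _] := f_bnd _ (mem_edges uu'); rewrite !addn_gt0 f_gt0 !orbT.
move=> A A'.
case/cart_edgeP=> [u v1 v2 vv ->|u1 u2 v uu ->];
  case/cart_edgeP=> [u' v1' v2' vv' ->|u1' u2' v' uu' ->].
- rewrite !cart_labeling1 => -[] /radix[//|//|/g_inj gE /pos_inj ->].
  by rewrite !cart_setl gE ?mem_edges.
- have := lab1_le u _ (mem_edges vv); have /andP[] := f_bnd _ (mem_edges uu').
  by rewrite cart_labeling1 cart_labeling2 //; lia.
- have := lab1_le u' _ (mem_edges vv'); have /andP[] := f_bnd _ (mem_edges uu).
  by rewrite cart_labeling1 cart_labeling2 //; lia.
have /andP[f_gt0 f_le] := f_bnd _ (mem_edges uu).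
have /andP[f_gt0' f_le'] := f_bnd _ (mem_edges uu').
rewrite !cart_labeling2 // -!addnA => /addnI e.
(* The values of [f] start at 1, so their predecessors serve as digits. *)
have [|||/ord_inj-> fE] :=
  @radix #|edges G1| (ord v) (f [set u1; u2]).-1 (ord v') (f [set u1'; u2']).-1.
- by rewrite prednK.
- by rewrite prednK.
- by apply: succn_inj; rewrite -!addnS !prednK.
by rewrite !cart_setr (f_inj _ _ (mem_edges uu) (mem_edges uu')) // -(prednK f_gt0) fE prednK.
Qed.

Lemma cart_antimagic k1 k2 f :
  regular G1 k1 -> (forall v : G2, 0 < deg v <= k2) -> edge_labeling f ->
  (forall u u' : G1,
    vertex_sum f u + k2 * (#|G1| - 1) < vertex_sum f u' + k1 * #|edges G1|) ->
  antimagic G.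
Proof.
move=> G1_reg G2_deg f_lab f_spread.
pose g (B : {set G2}) := index B (enum (edges G2)).
(* The part of the sum at [(u, v)] coming from copies of [G2] that does not depend on [u]; the
   offsets add [deg v * pos u]. *)
pose base v := \sum_(B in edges G2 | v \in B) (#|G1| * g B).+1.
have [pos [pos_inj pos_lt pos_mono]] := rank_by (vertex_sum f).
have [ord [ord_inj ord_lt ord_mono]] := rank_by base.
exists (cart_labeling pos ord f g); split.
  apply: cart_labelingP => // [A B|B eB].
    by move=> eA eB; apply: (@index_inj _ A); rewrite mem_enum.
  by rewrite cardE index_mem mem_enum.
have degE (H : sgraph) (w : H) : #|adj w| = deg w.
  by apply: eq_card => z; rewrite inE.
have sumE u v : vertex_sum (cart_labeling pos ord f g) ((u, v) : G) =
    base v + deg v * pos u + k1 * (#|G1| * #|edges G2| + #|edges G1| * ord v) + vertex_sum f u.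
  rewrite /vertex_sum sum_edges_at sum_cart_adj -addnA; congr (_ + _).
    under eq_bigr do rewrite cart_labeling1 -addSn.
    by rewrite big_split /= /base sum_edges_at sum_nat_const degE.
  under eq_bigr => u' uu' do rewrite cart_labeling2 //.
  by rewrite big_split /= sum_edges_at sum_nat_const degE G1_reg.
(* Strictness comes from [deg v > 0] in the term [deg v * pos u]; the sums under [f] are only weakly
   monotone in [pos]. *)
have pos_strict u u' v : pos u < pos u' ->
    vertex_sum (cart_labeling pos ord f g) ((u, v) : G)
    < vertex_sum (cart_labeling pos ord f g) ((u', v) : G).
  move=> lt_uu'; rewrite !sumE -!addnA ltn_add2l -addSn leq_add //.
    by rewrite ltn_pmul2l //; case/andP: (G2_deg v).
  by rewrite leq_add2l pos_mono.
(* The gain of [k1 * #|edges G1|] outweighs the possible losses in [deg v * pos u] and in the sum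
   under [f], while [base] does not decrease. *)
have ord_strict u u' v v' : ord v < ord v' ->
    vertex_sum (cart_labeling pos ord f g) ((u, v) : G)
    < vertex_sum (cart_labeling pos ord f g) ((u', v') : G).
  move=> lt_vv'; rewrite !sumE; have := ord_mono _ _ lt_vv'; have := f_spread u u'.
  have : deg v * pos u <= k2 * (#|G1| - 1).
    by apply: leq_mul; [case/andP: (G2_deg v)|have := pos_lt u; lia].
  have : k1 * (#|G1| * #|edges G2| + #|edges G1| * ord v) + k1 * #|edges G1|
      <= k1 * (#|G1| * #|edges G2| + #|edges G1| * ord v').
    by rewrite -mulnDr leq_mul2l -addnA [_ * ord v + _]addnC -mulnS
      leq_add2l leq_mul2l lt_vv' !orbT.
  by move: (vertex_sum _ _) (vertex_sum _ _) => a b; lia.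
case=> u v [u' v'] sum_eq.
have [lt|lt|/ord_inj eq_v] := ltngtP (ord v) (ord v').
- by have := ord_strict u u' _ _ lt; rewrite sum_eq ltnn.
- by have := ord_strict u' u _ _ lt; rewrite sum_eq ltnn.
rewrite -{v'}eq_v in sum_eq *.
have [lt|lt|/pos_inj -> //] := ltngtP (pos u) (pos u').
- by have := pos_strict _ _ v lt; rewrite sum_eq ltnn.
- by have := pos_strict _ _ v lt; rewrite sum_eq ltnn.
Qed.

End Product.

(** * Numerical estimates for the two parities of the degree *)

Theorem theorem1p2 (G1 G2 : sgraph) (n1 k1 k2 : nat)
  (G1_order : #|G1| = n1)
  (G1_connected : connected G1)
  (G1_regular : regular G1 k1)
  (G2_max : max_degree G2 <= k2)
  (G2_min : 1 <= min_degree G2)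
  (k1_k2 : (odd k1 /\ (k1 ^ 2 - k1) %/ 2 >= k2) \/
           [/\ ~~ odd k1, k1 ^ 2 %/ 2 >= k2 & ~ (k1 = 2 /\ k2 = 2)]) :
  antimagic (cart_prod G1 G2).
Proof.
have deg_G2 (v : G2) : 0 < deg v <= k2.
  apply/andP; split; last exact: leq_trans (leq_bigmax (F := @deg G2) v) G2_max.
  exact: leq_trans G2_min (min_degree_le v).
have k2_gt0 : 0 < k2.
  have [v _|G2_empty] := pickP (fun v : G2 => true).
    by case/andP: (deg_G2 v) => /leq_trans; apply.
  (* An empty [G2] would have minimum degree 0, the default of the minimum. *)
  by move: G2_min; rewrite /min_degree big_pred0 // eq_card0.
have m1E := regular_card_edges G1_regular.
have [x _|G1_empty] := pickP (fun u : G1 => true); last first.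
  have no_edges : edges G1 = set0.
    apply/setP=> A; rewrite inE; apply/negP => /edgesP[u _].
    by have := G1_empty u.
  apply: (cart_antimagic (f := fun=> 0) G1_regular deg_G2) => [|u]; last by have := G1_empty u.
  by apply: edge_labeling_inj => [A|A B]; rewrite no_edges inE.
have k1_lt : k1 < #|G1|.
  rewrite -(G1_regular x) -[leqRHS]cardsT; apply: proper_card.
  by rewrite properT; apply: contraTneq (in_setT x) => <-; rewrite inE adj_irrefl.
case: k1_k2 => [[k1_odd k2_le]|[k1_even k2_le not22]].
  have [h k1E] : exists h, k1 = (2 * h).+1 by exists k1./2; lia.
  subst k1.
  have [f f_lab f_sum] := odd_regular_labeling G1_regular.
  apply: (cart_antimagic G1_regular deg_G2 f_lab) => u u'; have := f_sum u u'.
  have {}k2_le : k2 <= h * (2 * h).+1.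
    by move: k2_le; rewrite -mulnn -[X in _ - X]mul1n -mulnBl subn1 -mulnA mulKn.
  move: (vertex_sum _ _) (vertex_sum _ _) k2_le m1E k1_lt => a b.
  (* From [n * (2 * h).+1 = 2 * m] follows [k2 * (n - 1) <= 2 * h * m - h * (2 * h).+1], and
     [h <= h * (2 * h).+1] leaves room for the spread [m + 2 * h - 1]. *)
  move: #|G1| #|edges G1| => n m; nia.
have [h k1E] : exists h, k1 = 2 * h by exists k1./2; lia.
subst k1.
have [f f_lab f_sum] := even_regular_labeling x G1_connected G1_regular.
apply: (cart_antimagic G1_regular deg_G2 f_lab) => u u'; have := f_sum u u'.
have {}k2_le : k2 <= 2 * h * h.
  by move: k2_le; rewrite -mulnn -mulnA mulKn // mulnCA mulnA.
move: (vertex_sum _ _) (vertex_sum _ _) k2_le m1E k1_lt => a b.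
move: #|G1| #|edges G1| => n m k2_le nm n_gt ab.
have -> : m = n * h by lia.
have := leq_mul k2_le (leqnn (n - 1)).
(* For [1 < h] the slack [2 * h * h] exceeds the spread [2 * h]. For [h = 1] they are equal, and the
   excluded pair forces [k2 = 1]; [h = 0] contradicts [0 < k2]. *)
have [h1|h_gt1] : h = 1 \/ 1 < h by nia.
  by subst h; have : k2 = 1 by [lia]; lia.
by nia.
Qed.
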